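(* Let $\Lambda\subseteq(0,\infty)$ be a nonempty set of scales with the usual order, and let $(s_\lambda)_{\lambda\in\Lambda}$ be the confidence functions of a scale family of semantic presentations over a countable first-order language $\mathcal{L}$, decisive on $\operatorname{Sent}(\mathcal{L})$. Assume $\varphi\in T_\infty$ and suppose there are constants $a>0$, $\alpha>0$ and $\lambda_1$ such that \[ 1-s_\lambda(\varphi)\le a\lambda^{-\alpha}\qquad\text{for all }\lambda\in\Lambda,\ \lambda\ge\lambda_1 . \] Let $\tau\in(0,1)$ and put $L_\tau=\max\bigl\{\lambda_1,\bigl(\tfrac{a}{1-\tau}\bigr)^{1/\alpha}\bigr\}$. Then $s_\lambda(\varphi)\ge\tau$ for all $\lambda\in\Lambda$ with $\lambda\ge L_\tau$; and for the strict threshold, after an arbitrarily small enlargement of the bound: for every $\delta>0$, $\varphi\in T_{\lambda,\tau}$ for all $\lambda\in\Lambda$ with $\lambda\ge L_\tau+\delta$.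
   Context: For each scale $\lambda$, $\mathcal{K}_\lambda$ is a nonempty class of $\mathcal{L}$-structures with a probability measure $\mu_\lambda$ (the posterior for a context $c_\lambda$) on a $\sigma$-algebra containing all sets $[\![\varphi]\!]=\{\mathfrak{M}\in\mathcal{K}_\lambda:\mathfrak{M}\models\varphi\}$ for sentences $\varphi$, and $s_\lambda(\varphi):=\mu_\lambda([\![\varphi]\!])\in[0,1]$. The family is decisive on $\operatorname{Sent}(\mathcal{L})$ if for every sentence $\varphi$ the limit $\lim_\lambda s_\lambda(\varphi)$ along the directed set $\Lambda$ exists and lies in $\{0,1\}$; then $T_\infty:=\{\varphi:\lim_\lambda s_\lambda(\varphi)=1\}$. For $\tau\in(0,1)$, $T_{\lambda,\tau}:=\{\varphi\in\operatorname{Sent}(\mathcal{L}):s_\lambda(\varphi)>\tau\}$. *)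

(* Defs.v *)
From HB Require Import structures.
From mathcomp Require Import all_boot all_order all_algebra.
From mathcomp Require Import all_classical all_reals all_analysis.
Import Order.TTheory GRing.Theory Num.Theory.
Import numFieldNormedType.Exports.

Set Implicit Arguments.
Unset Strict Implicit.
Unset Printing Implicit Defensive.

Local Open Scope classical_set_scope.
Local Open Scope ring_scope.

Record language := Language {
  fsym : Type;
  rsym : Type;
  fun_arity : fsym -> nat;
  rel_arity : rsym -> nat }.

Definition countable_language (L : language) : Prop :=
  countable [set: fsym L] /\ countable [set: rsym L].

(** Well-scoped de Bruijn syntax: [term L n] and [formula L n] have their free
    variables in ['I_n]; a quantifier binds index [0] and shifts the others. *)
Inductive term (L : language) (n : nat) : Type :=
| Var of 'I_n
| App (f : fsym L) of ('I_(fun_arity f) -> term L n).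

Inductive formula (L : language) : nat -> Type :=
| Falsum n : formula L n
| Equal n of term L n & term L n : formula L n
| Rel n (r : rsym L) of ('I_(rel_arity r) -> term L n) : formula L n
| Neg n of formula L n : formula L n
| And n of formula L n & formula L n : formula L n
| Or n of formula L n & formula L n : formula L n
| Imp n of formula L n & formula L n : formula L n
| All n of formula L n.+1 : formula L n
| Ex n of formula L n.+1 : formula L n.

Definition sentence (L : language) : Type := formula L 0.

Record model (L : language) := Model {
  domain :> Type;
  domain_inhabited : inhabited domain;
  fun_interp : forall f : fsym L, ('I_(fun_arity f) -> domain) -> domain;
  rel_interp : forall r : rsym L, ('I_(rel_arity r) -> domain) -> Prop }.

Definition env_cons (T : Type) (n : nat) (x : T) (e : 'I_n -> T)
    (i : 'I_n.+1) : T :=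
  if unlift ord0 i is Some j then e j else x.

Definition env_nil (T : Type) (i : 'I_0) : T :=
  False_rect T (notF (ltn_ord i)).

Fixpoint eval (L : language) (M : model L) (n : nat) (e : 'I_n -> M)
    (t : term L n) : M :=
  match t with
  | Var i => e i
  | App f ts => fun_interp (fun i => eval e (ts i))
  end.

Fixpoint sat (L : language) (M : model L) (n : nat) (phi : formula L n) :
    ('I_n -> M) -> Prop :=
  match phi with
  | Falsum _ => fun _ => False
  | Equal _ t u => fun e => eval e t = eval e u
  | Rel _ r ts => fun e => rel_interp (fun i => eval e (ts i))
  | Neg _ p => fun e => ~ sat p e
  | And _ p q => fun e => sat p e /\ sat q e
  | Or _ p q => fun e => sat p e \/ sat q e
  | Imp _ p q => fun e => sat p e -> sat q e
  | All _ p => fun e => forall x : M, sat p (env_cons x e)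
  | Ex _ p => fun e => exists x : M, sat p (env_cons x e)
  end.

Definition models (L : language) (M : model L) (phi : sentence L) : Prop :=
  sat phi (@env_nil M).

(** A nonempty class of models as a type of its own. The point, required by
    [measurableType], is an arbitrary member of the class and plays no role. *)
Definition class_space (L : language) (K : set (model L)) (K0 : K !=set0) :
    Type :=
  set_type K.

Section class_space_pointed.
Context (L : language) (K : set (model L)) (K0 : K !=set0).

Definition class_point : class_space K0 :=
  let: exist M KM := cid K0 in exist _ M (mem_set KM).

HB.instance Definition _ := gen_eqMixin (class_space K0).
HB.instance Definition _ := gen_choiceMixin (class_space K0).
HB.instance Definition _ := isPointed.Build (class_space K0) class_point.
End class_space_pointed.

Definition truth_set (L : language) (K : set (model L)) (K0 : K !=set0)
    (phi : sentence L) : set (class_space K0) :=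
  [set M | models (sval M) phi].
Arguments truth_set {L K} K0 phi.

(** As [events] is a sigma-algebra, the measurable sets of
    [g_sigma_algebraType events], i.e. [<<s events>>], are exactly [events]
    ([measurable_g_measurableTypeE]). *)
Record semantic_presentation (L : language) (R : realType) :=
  SemanticPresentation {
    model_class : set (model L);
    model_class_nonempty : model_class !=set0;
    events : set (set (class_space model_class_nonempty));
    events_sigma_algebra : sigma_algebra setT events;
    truth_set_event : forall phi : sentence L,
      events (truth_set model_class_nonempty phi);
    posterior : probability (g_sigma_algebraType events) R }.
Arguments events {L R} s _.

Definition confidence (L : language) (R : realType)
    (S : semantic_presentation L R) (phi : sentence L) : R :=
  fine (posterior S (truth_set (model_class_nonempty S) phi)).

(** The tail filter of the directed set [Lambda], which need not be unbounded;
    when [Lambda] has a largest element, limits are values at that element. *)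
Definition scale_filter (R : realType) (Lambda : set R) : set_system Lambda :=
  filter_from [set: Lambda] (fun l0 => [set l : Lambda | sval l0 <= sval l]).

Lemma scale_filter_proper (R : realType) (Lambda : set R) :
  Lambda !=set0 -> ProperFilter (@scale_filter R Lambda).
Proof.
move=> [x Lx]; apply: filter_from_proper.
  apply: filter_from_filter; first by exists (exist _ x (mem_set Lx)).
  move=> i j _ _; have [ij|ji] := leP (sval i) (sval j).
    by exists j => // k /= jk; split => //; apply: le_trans jk.
  by exists i => // k /= ik; split => //; apply: le_trans ik; exact: ltW.
by move=> i _; exists i => /=.
Qed.

Section scale_family.
Context (L : language) (R : realType) (Lambda : set R).
Variable S : Lambda -> semantic_presentation L R.

Definition decisive : Prop :=
  forall phi : sentence L, exists2 x : R, x = 0 \/ x = 1 &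
    (fun l : Lambda => confidence (S l) phi) @ @scale_filter R Lambda --> x.

Definition limit_theory : set (sentence L) :=
  [set phi | (fun l : Lambda => confidence (S l) phi)
               @ @scale_filter R Lambda --> (1 : R)].

Definition threshold_theory (l : Lambda) (tau : R) : set (sentence L) :=
  [set phi | tau < confidence (S l) phi].
End scale_family.

(* Main.v *)
Require Import Defs.
From mathcomp Require Import all_boot all_order all_algebra.
From mathcomp Require Import all_classical all_reals all_analysis.
Import Order.TTheory GRing.Theory Num.Theory.
Local Open Scope classical_set_scope.
Local Open Scope ring_scope.

(** The error bound [a * x]^ (- alpha)[decreases in]x > 0[and equals]1 - tau[exactly at]x = (a / (1
    - tau)) [^ (1 / alpha)]. From that scale on, and past [lambda1] where the rate applies, the
    error [1 - s(phi)] is at most [1 - tau], so the confidence is at least [tau]. Strictly beyond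
    that scale the decrease is strict, which gives the strict threshold. [power_rate_le] and
    [power_rate_lt] solve the two inequalities, with [c] standing for [1 - tau]. *)

Lemma power_rate_le {R : realType} {a c alpha x : R} :
  0 < a -> 0 < c -> 0 < alpha -> (a / c) `^ (1 / alpha) <= x ->
  a * x `^ (- alpha) <= c.
Proof.
move=> a0 c0 al0 hx.
have ac0 : 0 < a / c by rewrite divr_gt0.
have x0 : 0 < x by apply: lt_le_trans hx; rewrite powR_gt0.
rewrite powRN ler_pdivrMr ?powR_gt0 // mulrC -ler_pdivrMr //.
have -> : a / c = ((a / c) `^ (1 / alpha)) `^ alpha.
  by rewrite -powRrM div1r mulVf ?gt_eqF // powRr1 // ltW.
by apply: ge0_ler_powR hx; rewrite ?nnegrE ?powR_ge0 // ltW.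
Qed.

Lemma power_rate_lt {R : realType} {a c alpha x : R} :
  0 < a -> 0 < c -> 0 < alpha -> (a / c) `^ (1 / alpha) < x ->
  a * x `^ (- alpha) < c.
Proof.
move=> a0 c0 al0 hx.
have y0 : 0 < (a / c) `^ (1 / alpha) by rewrite powR_gt0 ?divr_gt0.
have x0 : 0 < x := lt_trans y0 hx.
(* Compare with the critical scale itself, where the weak bound already holds; the negative power
   strictly decreases from there to [x]. *)
apply: lt_le_trans (power_rate_le a0 c0 al0 (lexx _)).
rewrite ltr_pM2l // !powRN ltf_pV2 ?posrE ?powR_gt0 ?divr_gt0 //.
by apply: gt0_ltr_powR hx; rewrite // nnegrE ltW.
Qed.

Theorem theorem6p5 (R : realType) (L : language)
    (L_countable : countable_language L)
    (Lambda : set R)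
    (Lambda_pos : forall l : R, Lambda l -> 0 < l)
    (Lambda_nonempty : Lambda !=set0)
    (S : Lambda -> semantic_presentation L R)
    (S_decisive : decisive S)
    (phi : sentence L) (phi_limit : limit_theory S phi)
    (a alpha lambda1 : R) (a_gt0 : 0 < a) (alpha_gt0 : 0 < alpha)
    (rate : forall l : Lambda, lambda1 <= sval l ->
      1 - confidence (S l) phi <= a * sval l `^ (- alpha))
    (tau : R) (tau_gt0 : 0 < tau) (tau_lt1 : tau < 1) :
  let L_tau := Num.max lambda1 ((a / (1 - tau)) `^ (1 / alpha)) in
  (forall l : Lambda, L_tau <= sval l -> tau <= confidence (S l) phi) /\
  (forall delta : R, 0 < delta ->
    forall l : Lambda, L_tau + delta <= sval l ->
      threshold_theory S l tau phi).
Proof.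
move=> L_tau; have tau1 : 0 < 1 - tau by rewrite subr_gt0.
split=> [l|delta delta0 l hl].
  rewrite ge_max => /andP[/rate hr hl].
  have := le_trans hr (power_rate_le a_gt0 tau1 alpha_gt0 hl).
  by rewrite lerD2l lerN2.
(* The only role of [delta] is to put the scale strictly beyond [L_tau]. *)
have : L_tau < sval l by apply: lt_le_trans hl; rewrite ltrDl.
rewrite gt_max => /andP[/ltW/rate hr {}hl].
have := le_lt_trans hr (power_rate_lt a_gt0 tau1 alpha_gt0 hl).
by rewrite ltrD2l ltrN2.
Qed.
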